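(* Let $n\ge 1$, let $N$ be a multiplicative, unitarily invariant, self-adjoint norm on $\mathbb{M}_n$, and let $\alpha\in[0,\pi/2)$. If $X\in\mathbb{M}_n$ and the numerical range $W(X)$ is a subset of $S_\alpha$, then $$\omega_N(\operatorname{Im}(X))\le \tan(\alpha)\,\omega_N(\operatorname{Re}(X)).$$
   Context: $\mathbb{M}_n$ is the algebra of $n\times n$ complex matrices. A norm $N$ on $\mathbb{M}_n$ is multiplicative if $N(XY)\le N(X)N(Y)$ for all $X,Y\in\mathbb{M}_n$; unitarily invariant if $N(UXV)=N(X)$ for all $X\in\mathbb{M}_n$ and all unitary $U,V\in\mathbb{M}_n$; self-adjoint if $N(X^* )=N(X)$ for all $X$. Here $\operatorname{Re}(X)=\frac{X+X^*}{2}$ and $\operatorname{Im}(X)=\frac{X-X^*}{2i}$, and the generalized numerical radius induced by $N$ is $\omega_N(X)=\sup_{\theta\in\mathbb{R}}N(\operatorname{Re}(e^{i\theta}X))$. The numerical range of $X$ is $W(X)=\{\langle Xx,x\rangle: x\in\mathbb{C}^n,\ \|x\|=1\}$, and $S_\alpha=\{x+iy\in\mathbb{C}: x>0,\ |y|\le \tan(\alpha)\,x\}$. *)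

(* Defs.v *)
From HB Require Import structures.
From mathcomp Require Import all_boot all_order all_algebra.
From mathcomp Require Import complex.
From mathcomp Require Import all_classical all_reals all_analysis.

Set Implicit Arguments.
Unset Strict Implicit.
Unset Printing Implicit Defensive.

Import Order.TTheory GRing.Theory Num.Theory.
Local Open Scope ring_scope.
Local Open Scope classical_set_scope.
Local Open Scope sesquilinear_scope.
Local Open Scope complex_scope.

Record is_matrix_norm (R : realType) (n : nat) (N : 'M[R[i]]_n -> R) : Prop := {
  matrix_norm_ge0 : forall X, 0 <= N X;
  matrix_norm_eq0 : forall X, N X = 0 -> X = 0;
  matrix_normZ : forall (a : R[i]) X, N (a *: X) = complex.Re `|a| * N X;
  matrix_normD : forall X Y, N (X + Y) <= N X + N Y }.

Definition multiplicative_norm (R : realType) (n : nat)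
    (N : 'M[R[i]]_n -> R) : Prop :=
  forall X Y, N (X *m Y) <= N X * N Y.

Definition unitarily_invariant (R : realType) (n : nat)
    (N : 'M[R[i]]_n -> R) : Prop :=
  forall X U V, U \is unitarymx -> V \is unitarymx -> N (U *m X *m V) = N X.

Definition self_adjoint_norm (R : realType) (n : nat)
    (N : 'M[R[i]]_n -> R) : Prop :=
  forall X, N (X ^t*) = N X.

Definition re_mx (R : realType) (n : nat) (X : 'M[R[i]]_n) : 'M[R[i]]_n :=
  2%:R^-1 *: (X + X ^t*).

Definition im_mx (R : realType) (n : nat) (X : 'M[R[i]]_n) : 'M[R[i]]_n :=
  (2%:R * 'i)^-1 *: (X - X ^t*).

Definition expi (R : realType) (theta : R) : R[i] := cos theta +i* sin theta.

(* [sup] is the real supremum, with value 0 on unbounded sets; for a norm [N]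
   the set below is bounded by [N (re_mx X) + N (im_mx X)]. *)
Definition numerical_radius (R : realType) (n : nat) (N : 'M[R[i]]_n -> R)
    (X : 'M[R[i]]_n) : R :=
  sup [set N (re_mx (expi theta *: X)) | theta in [set: R]].

(* Linear in the first argument: u_1 conj(v_1) + ... + u_n conj(v_n). *)
Definition inner_prod (R : realType) (n : nat) (u v : 'cV[R[i]]_n) : R[i] :=
  (v ^t* *m u) ord0 ord0.

Definition euclidean_norm (R : realType) (n : nat) (x : 'cV[R[i]]_n) : R :=
  Num.sqrt (complex.Re (inner_prod x x)).

Definition numerical_range (R : realType) (n : nat) (X : 'M[R[i]]_n) :
    set R[i] :=
  [set inner_prod (X *m x) x | x in [set x : 'cV[R[i]]_n | euclidean_norm x = 1]].

Definition sector (R : realType) (alpha : R) : set R[i] :=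
  [set z | 0 < complex.Re z /\ `|complex.Im z| <= tan alpha * complex.Re z].

(* Main.v *)
(** A Hermitian matrix H has numerical radius N(H), so the claim reads
    N(Im X) <= tan(alpha) N(Re X). Let a unitary P diagonalize Im X and let z_j
    be the diagonal entries of P X P^*: they lie in W(X), and the diagonal
    entries of P (Re X) P^* and P (Im X) P^* are Re z_j and Im z_j, with
    |Im z_j| <= tan(alpha) Re z_j. Multiplying by a real diagonal contraction
    does not increase a unitarily invariant norm, because such a contraction is
    a convex combination of sign matrices; neither does passing to the diagonal
    part, which is an average of conjugates by sign matrices. Hence
    N(Im X) = N(diag(Im z)) <= tan(alpha) N(diag(Re z)) <= tan(alpha) N(Re X). *)
Require Import Defs.
From HB Require Import structures.
From mathcomp Require Import all_boot all_order all_algebra.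
From mathcomp Require Import complex.
From mathcomp Require Import all_classical all_reals all_analysis.
From mathcomp Require Import ring lra.

Set Implicit Arguments.
Unset Strict Implicit.
Unset Printing Implicit Defensive.

Import Order.TTheory GRing.Theory Num.Theory.
Local Open Scope ring_scope.
Local Open Scope classical_set_scope.
Local Open Scope complex_scope.

Lemma eq_ler (R : numDomainType) (x y : R) : x = y -> x <= y.
Proof. by move=> ->. Qed.

Section SesquilinearScope.
Local Open Scope sesquilinear_scope.

Section Adjoint.
Variables (R : realType) (n : nat).
Implicit Types X Y : 'M[R[i]]_n.

Lemma adjmxK m (Y : 'M[R[i]]_(m, n)) : (Y ^t*) ^t* = Y.
Proof. by apply/matrixP => j k; rewrite !mxE conjCK. Qed.

Lemma adjmxM m p (Y : 'M[R[i]]_(m, n)) (Z : 'M[R[i]]_(n, p)) :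
  (Y *m Z) ^t* = Z ^t* *m Y ^t*.
Proof. by rewrite trmx_mul map_mxM. Qed.

Lemma re_mx_adj X : (re_mx X) ^t* = re_mx X.
Proof.
apply/matrixP => j k; rewrite !mxE rmorphM rmorphD /= conjCK.
by rewrite fmorphV /= conjC_nat addrC.
Qed.

Lemma im_mx_adj X : (im_mx X) ^t* = im_mx X.
Proof.
apply/matrixP => j k; rewrite !mxE rmorphM rmorphB /= conjCK.
rewrite fmorphV rmorphM /= conjC_nat conjCi mulrN invrN mulNr -mulrN.
by rewrite opprB.
Qed.

(** Conjugation by [P] commutes with the adjoint, so the entry coming from [X ^t*] is the conjugate
    of [z]; half the sum and the difference over 2i then give its real and imaginary parts. *)
Lemma conj_diagE X (P : 'M[R[i]]_n) j (z := (P *m X *m P ^t*) j j) :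
  (P *m re_mx X *m P ^t*) j j = (complex.Re z)%:C /\
  (P *m im_mx X *m P ^t*) j j = (complex.Im z)%:C.
Proof.
have zJ : (P *m X ^t* *m P ^t*) j j = z^*%R.
  have -> : P *m X ^t* *m P ^t* = (P *m X *m P ^t*) ^t*.
    by rewrite !adjmxM adjmxK mulmxA.
  by rewrite 2!mxE.
split.
  rewrite -scalemxAr mulmxDr -scalemxAl mulmxDl 2!mxE zJ.
  by rewrite complexRe [RHS]ReE mulrC.
rewrite -scalemxAr mulmxBr -scalemxAl mulmxBl.
rewrite mxE [X in _ * X]mxE [X in _ + X]mxE zJ.
rewrite complexIm [RHS]ImE invfM invCi -/z.
ring.
Qed.

Lemma numerical_range_unitary X (P : 'M[R[i]]_n) j :
  P \is unitarymx -> numerical_range X ((P *m X *m P ^t*) j j).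
Proof.
move=> PU.
have rowE Y : (row j P *m Y *m (row j P) ^t*) 0 0 = (P *m Y *m P ^t*) j j.
  by rewrite -row_mul !mxE; apply: eq_bigr => k _; rewrite !mxE.
(* The witness is the adjoint of row j of [P]: its squared length is the (j, j) entry of P P^* =
   1. *)
exists ((row j P) ^t*); rewrite /= /euclidean_norm /inner_prod adjmxK.
  by rewrite -{1}[row j P]mulmx1 rowE mulmx1 (unitarymxP PU) mxE eqxx sqrtr1.
by rewrite mulmxA rowE.
Qed.
End Adjoint.

Section NormInequalities.
Variables (R : realType) (n : nat) (N : 'M[R[i]]_n -> R).
Hypothesis normN : is_matrix_norm N.
Implicit Types X M : 'M[R[i]]_n.

Lemma matrix_normZr (r : R) X : N (r%:C *: X) = `|r| * N X.
Proof. by rewrite (matrix_normZ normN) normc_def /= expr0n addr0 sqrtr_sqr. Qed.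

(** For Hermitian X, Re(e^{i theta} X) = cos(theta) X, so the values are |cos(theta)| N(X), with
    maximum at theta = 0. *)
Lemma numerical_radius_hermitian X : X ^t* = X -> numerical_radius N X = N X.
Proof.
move=> hX.
have reE theta : N (re_mx (expi theta *: X)) = `|cos theta| * N X.
  rewrite -matrix_normZr; congr N; apply/matrixP => j k; rewrite !mxE.
  have hjk : (X k j)^*%R = X j k by rewrite -[in RHS]hX !mxE.
  rewrite rmorphM /= hjk -mulrDl mulrA; congr (_ * _).
  by rewrite mulrC -ReE -complexRe.
apply/eqP; rewrite eq_le; apply/andP; split.
  apply: ge_sup; first by exists (N (re_mx (expi 0 *: X))); exists 0.
  move=> _ [theta _ <-]; rewrite reE ler_piMl ?(matrix_norm_ge0 normN)//.
  by rewrite ler_norml cos_geN1 cos_le1.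
apply: ub_le_sup; last by exists 0 => //; rewrite reE cos0 normr1 mul1r.
exists (N X) => _ [theta _ <-]; rewrite reE ler_piMl ?(matrix_norm_ge0 normN)//.
by rewrite ler_norml cos_geN1 cos_le1.
Qed.

Hypothesis uinvN : unitarily_invariant N.

Definition sign_mx (i : 'I_n) : 'M[R[i]]_n :=
  diag_mx (\row_j ((-1) ^+ (j == i))).

Lemma sign_mx_unitary i : sign_mx i \is unitarymx.
Proof.
apply/unitarymxP/matrixP => j k.
rewrite mul_diag_mx !mxE rmorphMn rmorphXn rmorphN1 /= [k == j]eq_sym.
have [->|_] := eqVneq j k; last by rewrite mulr0.
by rewrite mulr1n -expr2 sqrr_sign.
Qed.

Lemma norm_sign_mull i M : N (sign_mx i *m M) = N M.
Proof.
rewrite -[in RHS](uinvN M (sign_mx_unitary i) (V := 1%:M)) ?mulmx1//.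
by apply/unitarymxP; rewrite mul1mx trmx1 map_mx1.
Qed.

Lemma norm_diag_contract (c : 'I_n -> R) M : (forall j, `|c j| <= 1) ->
  N (diag_mx (\row_j (c j)%:C) *m M) <= N M.
Proof.
move=> c1.
(* Induction on [s] inserts the coefficients one index at a time; a repeated index changes
   nothing. *)
pose D (s : seq 'I_n) := diag_mx (\row_j (if j \in s then c j else 1)%:C).
suff H s : N (D s *m M) <= N M.
  apply: le_trans (H (enum 'I_n)); apply: eq_ler.
  by congr (N (diag_mx _ *m M)); apply/rowP => j; rewrite !mxE mem_enum.
elim: s => [|i s IHs].
  apply: eq_ler; congr N; apply/matrixP => j k.
  by rewrite mul_diag_mx !mxE mul1r.
have [si|si] := boolP (i \in s).
  apply: le_trans IHs; apply: eq_ler; congr (N (diag_mx _ *m M)).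
  by apply/rowP => j; rewrite !mxE in_cons; case: eqP => // ->; rewrite si.
(* diag(1, ..., c i, ..., 1) is a convex combination of 1 and [sign_mx i]. *)
have -> : D (i :: s) *m M =
    ((1 + c i) / 2)%:C *: (D s *m M) +
    ((1 - c i) / 2)%:C *: (sign_mx i *m (D s *m M)).
  apply/matrixP => j k; rewrite !mul_diag_mx !mxE in_cons.
  have [->|_] := eqVneq j i.
    have cE : c i = (1 + c i) / 2 - (1 - c i) / 2 by field.
    rewrite (negbTE si) /= rmorph1 expr1 {1}cE rmorphB /=; ring.
  rewrite /= expr0 !mul1r -mulrDl -rmorphD /=.
  by rewrite (_ : _ / 2 + _ = 1) ?mul1r//; field.
apply: le_trans (matrix_normD normN _ _) _.
(* The bound |c i| <= 1 makes both weights nonnegative, and they sum to 1. *)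
have := c1 i; rewrite ler_norml => /andP[c1l c1r].
rewrite !matrix_normZr norm_sign_mull -mulrDl !ger0_norm; [|lra|lra].
by rewrite (_ : _ / 2 + _ = 1) ?mul1r//; field.
Qed.

Lemma norm_diag_part M : N (diag_mx (\row_j M j j)) <= N M.
Proof.
(* Off-diagonal entries are cleared in the rows and columns listed in [s]; the full list leaves the
   diagonal part. *)
pose pinch (s : seq 'I_n) := \matrix_(j, k)
  (if (j == k) || (j \notin s) && (k \notin s) then M j k else 0).
suff H s : N (pinch s) <= N M.
  apply: le_trans (H (enum 'I_n)); apply: eq_ler; congr N.
  apply/matrixP => j k; rewrite !mxE !mem_enum orbF.
  by case: eqP => [->|]; rewrite ?mulr1n ?mulr0n.
elim: s => [|i s IHs].
  by apply: eq_ler; congr N; apply/matrixP => j k; rewrite !mxE orbT.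
(* Conjugation by [sign_mx i] negates exactly the off-diagonal entries of row i and column i, so
   averaging removes them. *)
have -> : pinch (i :: s) =
    (2^-1)%:C *: (pinch s + sign_mx i *m pinch s *m sign_mx i).
  apply/matrixP => j k; rewrite mul_diag_mx mul_mx_diag !mxE !in_cons.
  rewrite fmorphV rmorph_nat.
  have [->|jk] /= := eqVneq j k; first by case: (k == i); rewrite /=; field.
  have [ji|_] := eqVneq j i; last have [_|_] := eqVneq k i; rewrite /= ?andbF.
  - rewrite eq_sym -ji (negbTE jk) /=; ring.
  - ring.
  - by field.
rewrite matrix_normZr ger0_norm ?invr_ge0// mulrC ler_pdivrMr//.
apply: le_trans (matrix_normD normN _ _) _.
rewrite (uinvN _ (sign_mx_unitary i) (sign_mx_unitary i)); lra.
Qed.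

End NormInequalities.
End SesquilinearScope.

Theorem proposition2p2 (R : realType) (n : nat) (hn : (1 <= n)%N)
    (N : 'M[R[i]]_n -> R) (normN : is_matrix_norm N)
    (multN : multiplicative_norm N) (uinvN : unitarily_invariant N)
    (sadjN : self_adjoint_norm N)
    (alpha : R) (alpha_ge0 : 0 <= alpha) (alpha_lt : alpha < pi / 2%:R)
    (X : 'M[R[i]]_n) (rangeX : numerical_range X `<=` sector alpha) :
  numerical_radius N (im_mx X) <= tan alpha * numerical_radius N (re_mx X).
Proof.
rewrite !numerical_radius_hermitian ?re_mx_adj ?im_mx_adj//.
have /orthomx_spectralP : im_mx X \is normalmx.
  by apply/normalmxP; rewrite im_mx_adj.
set P := spectralmx _; set D := spectral_diag _ => imE.
have PU : P \is unitarymx by exact: spectral_unitarymx.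
have PJU : invmx P \is unitarymx by rewrite invmx_unitary// trmxC_unitary.
have zE j := conj_diagE X P j.
pose z j := (P *m X *m invmx P) j j.
rewrite -invmx_unitary // in zE.
have sectorz j : sector alpha (z j).
  by apply: rangeX; rewrite /z invmx_unitary//; exact: numerical_range_unitary.
have PBP : P *m im_mx X *m invmx P = diag_mx D.
  by rewrite imE !mulmxA mulmxV ?spectral_unit// mul1mx mulmxK ?spectral_unit.
have DE j : D 0 j = (complex.Im (z j))%:C.
  by have [_ <-] := zE j; rewrite PBP mxE eqxx mulr1n.
(* As n >= 1, there is a point z of the sector with Re z > 0 and 0 <= |Im z| <= tan(alpha) Re z. *)
have t_ge0 : 0 <= tan alpha.
  have [z_gt0 z_le] := sectorz (Ordinal hn).
  by rewrite -(pmulr_lge0 _ z_gt0) (le_trans _ z_le).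
pose A := P *m re_mx X *m invmx P.
have AE j : A j j = (complex.Re (z j))%:C by rewrite (zE j).1.
have -> : N (re_mx X) = N A by rewrite /A uinvN.
have -> : N (im_mx X) = N (diag_mx D) by rewrite -PBP uinvN.
clearbody A.
apply: (@le_trans _ _ (tan alpha * N (diag_mx (\row_j A j j)))); last first.
  by rewrite ler_wpM2l// norm_diag_part.
rewrite -{1}(ger0_norm t_ge0) -matrix_normZr//.
(* The sector condition gives |c_j| <= 1. If tan(alpha) = 0, the quotient is 0 by convention, and
   the sector forces Im z_j = 0, so the factorization below still holds. *)
pose c j := complex.Im (z j) / (tan alpha * complex.Re (z j)).
have -> : diag_mx D = diag_mx (\row_j (c j)%:C) *m
    ((tan alpha)%:C *: diag_mx (\row_j A j j)).
  apply/matrixP => j k; rewrite mul_diag_mx !mxE DE AE.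
  case: eqP => _; rewrite ?mulr0n ?mulr0// !mulr1n -!rmorphM /= /c.
  have [z_gt0 z_le] := sectorz j.
  have [t0|t0] := eqVneq (tan alpha) 0.
    move: z_le; rewrite t0 !mul0r normr_le0 => /eqP ->.
    by rewrite mulr0.
  by rewrite -/(z j) divfK // mulf_neq0 // gt_eqF.
apply: norm_diag_contract => // j.
have [z_gt0 z_le] := sectorz j.
have tz_ge0 : 0 <= tan alpha * complex.Re (z j) by rewrite mulr_ge0// ltW.
rewrite /c normrM normfV (ger0_norm tz_ge0).
have [->|tz0] := eqVneq (tan alpha * complex.Re (z j)) 0.
  by rewrite invr0 mulr0 ler01.
by rewrite ler_pdivrMr ?mul1r// lt_neqAle eq_sym tz0.
Qed.
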